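(* Let $d\ge 2$ be an integer. For $r\in\{2,3,4\}$ there is an inclusion of ideals $J_{1,d}\supseteq J_{r,d}$ in $\mathbf C[a_0,\dots,a_d]$.
   Context: The base field is $\mathbf C$. Let $\mathbb F=\sum_{i=0}^d\binom di a_i x_1^{d-i}x_2^i$ be the generic binary form of order (homogeneous degree) $d$, with independent indeterminates $a_0,\dots,a_d$. For $r\ge1$, and a form $A$ of order $r$, put $(A,\mathbb F)_1=\frac1{rd}\left(\frac{\partial A}{\partial x_1}\frac{\partial \mathbb F}{\partial x_2}-\frac{\partial A}{\partial x_2}\frac{\partial \mathbb F}{\partial x_1}\right)$, and let $C_i=(x_1^{r-i}x_2^i,\mathbb F)_1$ for $0\le i\le r$. Let $\mathfrak G_{r,d}$ be the determinant of the $(r+1)\times(r+1)$ matrix with $(i,j)$ entry $\frac{\partial^r C_i}{\partial x_1^{r-j}\partial x_2^j}$, $0\le i,j\le r$; it is a form of order $(r+1)(d-2)$ in $x_1,x_2$ whose coefficients are homogeneous of degree $r+1$ in the $a_i$. $J_{r,d}$ denotes the ideal of $\mathbf C[a_0,\dots,a_d]$ generated by the coefficients of $\mathfrak G_{r,d}$ viewed as a form in $x_1,x_2$. *)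

(* Defs.v *)
From HB Require Import structures.
From mathcomp Require Import all_boot all_order all_algebra.
From mathcomp.multinomials Require Import mpoly.

Set Implicit Arguments.
Unset Strict Implicit.
Unset Printing Implicit Defensive.

Import GRing.Theory.
Local Open Scope ring_scope.

(* A binary form in x_1, x_2 with coefficients in K[a_0, ..., a_d] is an
   element of {mpoly {mpoly K[d.+1]}[2]}: the inner variable 'X_i is a_i, and
   the outer variables 'X_0 and 'X_1 are x_1 and x_2. *)
Section BinaryForms.

Variables (K : fieldType) (d : nat).

Local Notation A := {mpoly K[d.+1]}.
Local Notation form := {mpoly A[2]}.

Definition x1 : form := 'X_0.
Definition x2 : form := 'X_1.

Definition dx1 (P : form) : form := mderiv 0 P.
Definition dx2 (P : form) : form := mderiv 1 P.

Definition generic_form : form :=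
  \sum_(i < d.+1) ('X_i *+ 'C(d, i) : A) *: (x1 ^+ (d - i) * x2 ^+ i).

(* (P, F)_1 for forms P of order r and F of order d; the orders are explicit
   because they cannot be read off a zero form. *)
Definition transvectant1 (r : nat) (P F : form) : form :=
  (((r * d)%:R^-1 : K)%:MP : A) *: (dx1 P * dx2 F - dx2 P * dx1 F).

Definition C_ (r i : nat) : form :=
  transvectant1 r (x1 ^+ (r - i) * x2 ^+ i) generic_form.

Definition G_ (r : nat) : form :=
  \det (\matrix_(i < r.+1, j < r.+1) iter (r - j) dx1 (iter j dx2 (C_ r i))).

End BinaryForms.

Definition ideal_gen (A : comNzRingType) (S : A -> Prop) (p : A) : Prop :=
  exists2 s : seq (A * A),
    (forall u, u \in s -> S u.2) & p = \sum_(u <- s) u.1 * u.2.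

Definition J_ (K : fieldType) (r d : nat) : {mpoly K[d.+1]} -> Prop :=
  ideal_gen (fun c => exists m : 'X_{1..2}, c = (G_ K d r)@_m).

(* Main.v *)
From HB Require Import structures.
Require Import Defs.
From mathcomp Require Import all_boot all_order all_algebra.
From mathcomp Require Import reals.
From mathcomp.real_closed Require Import complex.
From mathcomp Require Import ring zify.
From mathcomp.multinomials Require Import mpoly.

Set Implicit Arguments.
Unset Strict Implicit.
Unset Printing Implicit Defensive.

Import GRing.Theory.
Local Open Scope ring_scope.

(* Put x_1 = 1, x_2 = t, f(t) = F(1, t).  By Euler's identity G_r becomes a
   multiple of the Wronskian of c_i = r t^i f' - d (t^i)' f (0 <= i <= r), and
   since c_i is proportional to f^(1 + r/d) (t^i f^(-r/d))', this Wronskian is,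
   up to a constant, f^(r + 1 - r/d) (f^(r/d))^(r+1).  Now f^(r/d) = w^r with
   w = f^(1/d), and each term of the Leibniz expansion of (w^r)^(r+1) has a
   factor w^(k) with k >= 2; cleared of denominators, this factor lies in the
   differential ideal generated by f^(2 - 1/d) w'', which is proportional to
   the Hessian G_1. *)

Lemma sum_ord_widen (V : nmodType) n1 n2 (F : nat -> V) :
    (n1 <= n2)%N -> (forall i, (n1 <= i)%N -> F i = 0) ->
  \sum_(i < n2) F i = \sum_(i < n1) F i.
Proof.
move=> le_n F0; rewrite -!(big_mkord xpredT) (big_cat_nat (n := n1)) //=.
rewrite [X in _ + X]big_nat_cond [X in _ + X]big1 ?addr0 // => i.
by move=> /andP[/andP[/F0]].
Qed.

(** * Leibniz expansion of [r g f' - d g' f] *)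

Section LeibnizCoefficients.

Variables (r d : nat).

(* The multiple of v = g^(m) f^(l+1-m) in the l-th derivative of
   r g f' - d g' f. *)
Definition lcoef (V : zmodType) (m l : nat) (v : V) : V :=
  v *+ (r * 'C(l, m)) - v *+ (if m is m'.+1 then d * 'C(l, m') else 0).

Lemma lcoef_small (V : zmodType) m l (v : V) : (l.+1 < m)%N -> lcoef m l v = 0.
Proof.
by case: m => // m lt_lm; rewrite /lcoef !bin_small ?muln0 ?subr0 //; lia.
Qed.

Lemma lcoef_diag (V : zmodType) l (v : V) : lcoef l.+1 l v = - (v *+ d).
Proof. by rewrite /lcoef bin_small // binn muln0 muln1 sub0r. Qed.

Lemma lcoefD (V : zmodType) m l (u v : V) :
  lcoef m l (u + v) = lcoef m l u + lcoef m l v.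
Proof. by rewrite /lcoef !mulrnDl opprD addrACA. Qed.

Lemma lcoef_mul (A : comNzRingType) m l (u v : A) :
  lcoef m l (u * v) = u * lcoef m l v.
Proof. by rewrite /lcoef mulrBr !mulrnAr. Qed.

(** Pascal's rule in both binomial coefficients. *)
Lemma lcoefS (V : zmodType) m l (v : V) :
  lcoef m l.+1 v = lcoef m l v + (if m is m'.+1 then lcoef m' l v else 0).
Proof.
case: m => [|m]; rewrite /lcoef; first by rewrite !bin0 addr0.
rewrite binS mulnDr mulrnDr; case: m => [|m].
  by rewrite !bin0 subr0 addrAC.
by rewrite binS mulnDr mulrnDr opprD addrACA.
Qed.

(** One differentiation step: [X m j], standing for a product of an [m]-th and a [j]-th derivative,
    becomes [X m.+1 j + X m j.+1]. [X] stays abstract to serve both plain derivatives and their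
    weighted analogues. *)
Lemma sum_lcoefS (V : zmodType) (X : nat -> nat -> V) l :
  \sum_(m < l.+3) lcoef m l.+1 (X m (l.+2 - m)%N) =
  \sum_(m < l.+2) lcoef m l (X m.+1 (l.+1 - m)%N + X m (l.+1 - m).+1).
Proof.
under eq_bigr do rewrite lcoefS.
under [RHS]eq_bigr do rewrite addrC lcoefD.
rewrite [LHS]big_split [RHS]big_split /=; congr (_ + _); last first.
  rewrite [LHS]big_ord_recl /= add0r; apply: eq_bigr => i _.
  by rewrite subSS.
rewrite [LHS]big_ord_recr /= lcoef_small // addr0.
by apply: eq_bigr => i _; rewrite subSn // -ltnS.
Qed.

End LeibnizCoefficients.

(** * Derivatives of fractional powers of [f], and a determinant of Leibniz coefficients *)

Section WeightedPowers.

Variables (D : idomainType) (d : nat) (f : {poly D}).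

(* Formally f^(n - k/d) (f^(k/d))^(n), cleared of denominators by d^n. *)
Fixpoint wpow (k n : nat) : {poly D} :=
  if n is n'.+1 then
    f *+ d * (wpow k n')^`() + (k%:R - (n' * d)%:R) * f^`() * wpow k n'
  else 1.

(** Since g = f^(r/d) satisfies r g f' = d g' f, the [l]-th derivative of r g f' - d g' f is zero;
    the sum is this derivative times d^(l+1) f^(l+1-r/d). *)
Lemma sum_lcoef_wpow r l :
  \sum_(m < l.+2)
    lcoef r d m l ((f *+ d) ^+ (l.+1 - m) * wpow r m * f^`(l.+1 - m)) = 0.
Proof.
elim: l => [|l IHl].
  rewrite !big_ord_recl big_ord0 /= /lcoef /= /bump /=.
  rewrite !addn0 -polyC1 derivC !bin0 !bin_small // !muln0 !muln1 mul0n !mulr0n.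
  rewrite subnn subn0 expr0 expr1; ring.
rewrite (sum_lcoefS r d (fun m j => (f *+ d) ^+ j * wpow r m * f^`(j))).
(* With n = l+1, [nabla] is differentiation under the weight: it sends d^n f^(n-r/d) u to d^(n+1)
   f^(n+1-r/d) u'. *)
pose nabla (p : {poly D}) :=
  f *+ d * p^`() + (r%:R - (l.+1 * d)%:R) * f^`() * p.
transitivity (nabla 0); last by rewrite /nabla deriv0 !mulr0 addr0.
rewrite -[X in nabla X]IHl {}/nabla raddf_sum /= !mulr_sumr -big_split /=.
apply: eq_bigr => m _; have le_ml : (m <= l.+1)%N by rewrite -ltnS.
set j := (l.+1 - m)%N; have def_l : (l.+1 = j + m)%N by rewrite subnK.
(* Of the weight [j + m], the part [j] cancels the derivative of [(f *+ d) ^+ j], and the part [m]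
   completes [wpow r m.+1]. *)
rewrite !natrM (congr1 (fun n : nat => n%:R : {poly D}) def_l).
have lcoef_deriv n n' (p : {poly D}) :
    (lcoef r d n n' p)^`() = lcoef r d n n' p^`().
  by rewrite /lcoef derivB !derivMn.
rewrite lcoef_deriv -!lcoef_mul -lcoefD; congr lcoef.
rewrite !derivM deriv_exp derivMn.
case: j {def_l} => [|j] /=; rewrite ?expr0 ?exprS; ring.
Qed.

Arguments wpow : simpl never.

Lemma wpowS k n : wpow k n.+1 =
  f *+ d * (wpow k n)^`() + (k%:R - (n * d)%:R) * f^`() * wpow k n.
Proof. by []. Qed.

Lemma wpow1 k : wpow k 1 = k%:R * f^`().
Proof. by rewrite wpowS /wpow -polyC1 derivC mulr0 add0r mulr1 subr0. Qed.

Lemma wpow_0S n : wpow 0 n.+1 = 0.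
Proof.
elim: n => [|n IHn]; first by rewrite wpow1 mul0r.
by rewrite wpowS IHn deriv0 !mulr0 addr0.
Qed.

Lemma deriv_transvectant r l (g : {poly D}) :
  (g * f^`() *+ r - g^`() * f *+ d)^`(l) =
  \sum_(m < l.+2) lcoef r d m l (g^`(m) * f^`(l.+1 - m)).
Proof.
elim: l => [|l IHl].
  rewrite !big_ord_recl big_ord0 /= /lcoef /= /bump /=.
  by rewrite !addn0 !bin0 bin_small // !muln0 !muln1 !mulr0n subr0 sub0r addr0.
rewrite derivnS IHl raddf_sum /= (sum_lcoefS r d (fun m j => g^`(m) * f^`(j))).
apply: eq_bigr => m _.
by rewrite /lcoef derivB !derivMn !derivM.
Qed.

(** Column [l] holds the coefficients of g, ..., g^(r) in the [l]-th derivative of r g f' - d g' f.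
    Where [l.+1 - m] truncates, [lcoef] vanishes. *)
Definition leibniz_mx r : 'M[{poly D}]_r.+1 :=
  \matrix_(m, l) lcoef r d m l f^`(l.+1 - m).

Hypothesis df_neq0 : f *+ d != 0.

(* The columns of the Hessenberg matrix [leibniz_mx r], paired with the
   derivatives of f^(r/d), give the equation f g' = (r/d) f' g differentiated
   0, ..., r times; Cramer's rule then isolates the top derivative. *)
Lemma det_leibniz_mx r : \det (leibniz_mx r) = wpow r r.+1.
Proof.
set B := leibniz_mx r; set e := f *+ d.
pose y : 'rV[{poly D}]_r.+1 := \row_m (e ^+ (r.+1 - m) * wpow r m).
(* Column [l < r] gives [e ^+ (r - l)] times [sum_lcoef_wpow], hence zero; the last column lacks the
   term [m = r.+1] of that sum, and the right side is its opposite. *)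
have yB : y *m B = (e * wpow r r.+1) *: delta_mx 0 ord_max.
  apply/rowP => l; rewrite !mxE eqxx /=.
  have := sum_lcoef_wpow r l; have [lt_lr|le_rl] := ltnP l r => sum0.
    have -> : (l == ord_max) = false.
      by apply/eqP => l_max; rewrite l_max ltnn in lt_lr.
    rewrite mulr0 -[RHS](mulr0 (e ^+ (r - l))) -[in RHS]sum0 mulr_sumr.
    pose F (m : nat) : {poly D} := e ^+ (r - l) *
      lcoef r d m l (e ^+ (l.+1 - m) * wpow r m * f^`(l.+1 - m)).
    rewrite -[RHS](@sum_ord_widen _ l.+2 r.+1 F) // => [|m]; last first.
      by move=> lt_lm; rewrite /F lcoef_small ?mulr0.
    apply: eq_bigr => m _; rewrite !mxE /F.
    have [le_ml|lt_lm] := leqP m l.+1; last by rewrite !lcoef_small // !mulr0.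
    have -> : (r.+1 - m = (r - l) + (l.+1 - m))%N by lia.
    by rewrite [in RHS]lcoef_mul exprD !mulrA.
  have def_l : l = r :> nat by apply/eqP; rewrite eqn_leq le_rl -ltnS ltn_ord.
  have -> : l == ord_max by apply/eqP/val_inj.
  rewrite mulr1; move/eqP: sum0; rewrite big_ord_recr def_l /= lcoef_diag subnn.
  rewrite expr0 derivn0 mul1r subr_eq0 => /eqP sumE.
  rewrite mulrC mulrnAr -sumE; apply: eq_bigr => m _.
  by rewrite !mxE -lcoef_mul def_l.
have := congr1 (mulmxr (\adj B)) yB.
rewrite /= -mulmxA mul_mx_adj mul_mx_scalar.
move/rowP/(_ 0); rewrite -scalemxAl -rowE !mxE /cofactor.
set M := row' _ _.
(* Without its first row and last column, [B] is upper triangular with diagonal [- e]; the sign of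
   the cofactor cancels that of [(- e) ^+ r]. *)
have -> : \det M = (- e) ^+ r.
  rewrite -det_tr det_trig; last first.
    apply/is_trig_mxP => i j lt_ij; rewrite !mxE lcoef_small //.
    by rewrite lift_max lift0.
  rewrite (eq_bigr (fun=> - e)) ?prodr_const ?card_ord // => i _.
  by rewrite !mxE lift_max lift0 lcoef_diag subnn.
rewrite [(- e) ^+ r]exprNn mulrA -exprD add0n addnn -signr_odd odd_double.
rewrite mul1r subn0.
have -> : wpow r 0 = 1 by [].
by rewrite mulr1 mulrAC -exprS mulrC => /(mulfI (expf_neq0 _ df_neq0)).
Qed.

End WeightedPowers.

Arguments wpow : simpl never.

(** * Ideals and their extension to polynomials *)

Section Ideals.

Record is_ideal (A : comNzRingType) (J : A -> Prop) : Prop := IsIdeal {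
  ideal0 : J 0;
  idealD : forall a b, J a -> J b -> J (a + b);
  idealM : forall a b, J b -> J (a * b) }.

Lemma ideal_sum (A : comNzRingType) (J : A -> Prop) (I : Type) (s : seq I)
    (P : pred I) (F : I -> A) :
  is_ideal J -> (forall i, P i -> J (F i)) -> J (\sum_(i <- s | P i) F i).
Proof.
move=> idJ JF; apply: (big_ind J) => //; first exact: ideal0.
exact: idealD.
Qed.

Lemma ideal_genP (A : comNzRingType) (S : A -> Prop) : is_ideal (ideal_gen S).
Proof.
split=> [|_ _ [s Ss ->] [t St ->]|a _ [s Ss ->]].
- by exists [::]; rewrite ?big_nil.
- exists (s ++ t); last by rewrite big_cat.
  by move=> u; rewrite mem_cat => /orP[/Ss|/St].
- exists [seq (a * u.1, u.2) | u <- s].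
    by move=> _ /mapP[u /Ss Su ->].
  by rewrite big_map mulr_sumr; apply: eq_bigr => u _; rewrite mulrA.
Qed.

Lemma ideal_gen_mem (A : comNzRingType) (S : A -> Prop) a :
  S a -> ideal_gen S a.
Proof.
move=> Sa; exists [:: (1, a)]; last by rewrite big_seq1 mul1r.
by move=> u; rewrite inE => /eqP ->.
Qed.

Lemma ideal_gen_min (A : comNzRingType) (S J : A -> Prop) :
  is_ideal J -> (forall a, S a -> J a) -> forall a, ideal_gen S a -> J a.
Proof.
move=> idJ SJ _ [s Ss ->]; rewrite big_seq; apply: ideal_sum => // u /Ss /SJ.
exact: idealM.
Qed.

Variables (A : comNzRingType) (J : A -> Prop).
Hypothesis idJ : is_ideal J.

Definition ideal_poly (p : {poly A}) : Prop := forall i, J p`_i.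

Lemma ideal_polyP : is_ideal ideal_poly.
Proof.
split=> [i|p q Jp Jq i|p q Jq i].
- by rewrite coef0; apply: ideal0.
- by rewrite coefD; apply: idealD.
- by rewrite coefM; apply: ideal_sum => // j _; apply: idealM.
Qed.

Lemma ideal_poly_deriv p : ideal_poly p -> ideal_poly p^`().
Proof. by move=> Jp i; rewrite coef_deriv -mulr_natl; apply: idealM. Qed.

End Ideals.

(** * Weighted powers modulo an ideal containing the coefficients of [wpow 1 2] *)

Section WeightedPowersIdeal.

Variables (D : idomainType) (d : nat) (f : {poly D}) (J : D -> Prop).
Hypothesis idJ : is_ideal J.
Hypothesis wpow12J : ideal_poly J (wpow d f 1 2).

Local Notation wpow := (wpow d f).

(* Modulo the differential ideal generated by w'', where w = f^(1/d),
   (w w^k)^(n) = w (w^k)^(n) + n w' (w^k)^(n-1). *)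
Lemma wpow_Leibniz k n :
  ideal_poly J (wpow k.+1 n - (wpow k n + n%:R * f^`() * wpow k n.-1)).
Proof.
have idJX := ideal_polyP idJ.
elim: n => [|n IHn]; first by rewrite !mul0r addr0 subrr; exact: (ideal0 idJX).
set del := (X in ideal_poly J X) in IHn.
(* The new error is the weighted derivative of the old one plus the term where w' is differentiated
   to w'', that is, [wpow 1 2]. *)
have -> : wpow k.+1 n.+1 - (wpow k n.+1 + n.+1%:R * f^`() * wpow k n.+1.-1) =
    f *+ d * del^`() + (k.+1%:R - (n * d)%:R) * f^`() * del
    + n%:R * wpow k n.-1 * wpow 1 2.
  rewrite /del; case: n {del IHn} => [|n] /=.
    have w0 m : wpow m 0 = 1 by [].
    by rewrite !wpow1 !w0 !mul0r !addr0 subrr deriv0; ring.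
  have deriv_nat m : (m%:R : {poly D})^`() = 0 by rewrite -polyC_natr derivC.
  rewrite (wpowS _ _ k.+1 n.+1) (wpowS _ _ k n.+1) (wpowS _ _ 1 1) wpow1.
  move: (wpow k n) (wpow k n.+1) (wpow k.+1 n.+1) (wpowS d f k n).
  move=> u v w def_v.
  rewrite !(derivD, derivN, derivM, deriv_nat, mul0r, add0r).
  by move: v^`() => dv; rewrite def_v; ring.
apply: (idealD idJX) => //; last exact: (idealM idJX).
by apply: (idealD idJX); apply: (idealM idJX) => //; exact: ideal_poly_deriv.
Qed.

(** Removing one factor w costs at most one derivative, so derivatives still outnumber factors, down
    to a derivative of the constant 1. *)
Lemma wpow_ideal k n : (k < n)%N -> ideal_poly J (wpow k n).
Proof.
have idJX := ideal_polyP idJ.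
elim: k n => [|k IHk] n lt_kn.
  by case: n lt_kn => // n _; rewrite wpow_0S; exact: (ideal0 idJX).
rewrite -[wpow _ _](subrK (wpow k n + n%:R * f^`() * wpow k n.-1)).
apply: (idealD idJX); first exact: wpow_Leibniz.
apply: (idealD idJX); first by apply: IHk; lia.
by apply: (idealM idJX); apply: IHk; lia.
Qed.

End WeightedPowersIdeal.

(** * Setting x_1 = 1 in binary forms *)

Section Dehomogenization.

Variable A : comNzRingType.
Local Notation form := {mpoly A[2]}.

Definition dehom : form -> {poly A} :=
  mmap polyC (fun i : 'I_2 => if i == 0 then 1 else 'X).

HB.instance Definition _ := GRing.RMorphism.on dehom.

Lemma mdeg2 (m : 'X_{1..2}) : mdeg m = (m 0%R + m 1%R)%N.
Proof.
rewrite mdegE !big_ord_recl big_ord0 addn0.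
by congr (m _ + m _)%N; apply: val_inj.
Qed.

Lemma dehomX (m : 'X_{1..2}) : dehom 'X_[m] = 'X^(m 1).
Proof.
rewrite /dehom mmapX /mmap1 !big_ord_recl big_ord0 /= expr1n mul1r mulr1.
by congr ('X^(m _)); apply: val_inj.
Qed.

Lemma dehomZ c P : dehom (c *: P) = c%:P * dehom P.
Proof. exact: mmapZ. Qed.

Lemma dehomE P : dehom P = \sum_(m <- msupp P) (P@_m)%:P * 'X^(m 1).
Proof.
rewrite {1}[P]mpolyE raddf_sum /=.
by apply: eq_bigr => m _; rewrite dehomZ dehomX.
Qed.

Lemma dehom_mderiv1 P : dehom (mderiv 1 P) = (dehom P)^`().
Proof.
rewrite (dehomE P) [X in mderiv 1 X]mpolyE (raddf_sum (mderiv 1)) !raddf_sum /=.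
apply: eq_bigr => m _; rewrite mderivZ mderivX !dehomZ dehomX polyC_natr.
rewrite derivM derivC mul0r add0r derivXn mulr_natl; congr (_ * ('X^_ *+ _)).
by rewrite mnmBE mnm1E eqxx subn1.
Qed.

(** Euler's identity x_1 P_1 + x_2 P_2 = M P at x_1 = 1, checked on monomials. *)
Lemma dehom_mderiv0 M P : P \is M.-homog ->
  dehom (mderiv 0 P) = M%:R * dehom P - 'X * (dehom P)^`().
Proof.
move=> homP; rewrite (dehomE P) [X in mderiv 0 X]mpolyE (raddf_sum (mderiv 0)).
rewrite raddf_sum /= raddf_sum /= !mulr_sumr -sumrB.
rewrite big_seq [RHS]big_seq; apply: eq_bigr => m /(dhomog_mf homP) degm.
rewrite mderivZ mderivX !dehomZ dehomX polyC_natr.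
rewrite derivM derivC mul0r add0r derivXn mnmBE mnm1E /= subn0.
have -> : M = (m 0%R + m 1%R)%N by rewrite -mdeg2; exact: esym degm.
rewrite natrD.
case: (m 1) => [|n]; rewrite /= ?mulr0n ?exprS; ring.
Qed.

Lemma dhomog_mderiv M (P : form) (i : 'I_2) :
  P \is M.-homog -> mderiv i P \is M.-1.-homog.
Proof.
move=> homP; apply/dhomogP => m; rewrite mcoeff_msupp mcoeff_mderiv => Pm.
suff <- : mdeg (m + U_(i))%MM = M by rewrite mdegD mdeg1 addn1.
apply/eqP; apply: contraNT Pm => /(dhomog_nemf_coeff homP) ->.
by rewrite mul0rn.
Qed.

Lemma dhomog_iter_mderiv M (P : form) (i : 'I_2) k :
  P \is M.-homog -> iter k (mderiv i) P \is (M - k).-homog.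
Proof.
move=> homP; elim: k => [|k IHk]; first by rewrite subn0.
by rewrite subnS; apply: dhomog_mderiv.
Qed.

Variable J : A -> Prop.
Hypothesis idJ : is_ideal J.

Lemma ideal_dehom P : (forall m, J P@_m) -> ideal_poly J (dehom P).
Proof.
move=> JP i; rewrite dehomE coef_sum; apply: ideal_sum => // m _.
by rewrite mulrC coefMC; apply: idealM.
Qed.

(** Among monomials of degree [e], the exponent of x_2 determines the monomial, so dehomogenization
    merges no coefficients. *)
Lemma ideal_homog e P m :
  P \is e.-homog -> ideal_poly J (dehom P) -> J P@_m.
Proof.
move=> homP /(_ (m 1)).
have [degm|/(dhomog_nemf_coeff homP) -> _] := eqVneq (mdeg m) e; last first.
  exact: ideal0.
rewrite dehomE coef_sum big_seq.
rewrite (eq_bigr (fun m' => if m' == m then P@_m else 0)) => [|m'].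
  rewrite -big_seq -big_mkcond /=; have [mP|mP] := boolP (m \in msupp P).
    by rewrite -big_filter filter_pred1_uniq ?msupp_uniq // big_seq1.
  by rewrite memN_msupp_eq0 //; move=> _; apply: ideal0.
move=> /(dhomog_mf homP) degm'; rewrite coefCM coefXn.
have [->|m'_m] := eqVneq m' m; first by rewrite eqxx mulr1.
have [m1|] := eqVneq (m 1) (m' 1); last by rewrite mulr0.
case/eqP: m'_m; apply/mnmP => i.
have m0 : m' 0 = m 0.
  have : mdeg m' = mdeg m by rewrite degm; exact: degm'.
  by rewrite !mdeg2 m1 => /addIn.
case: i => [[|[|//]] lt_i].
  by move: m0; congr (m' _ = m _); apply: val_inj.
by move: (esym m1); congr (m' _ = m _); apply: val_inj.
Qed.

End Dehomogenization.

(** * Homogeneity of determinants and iterated Euler identities *)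

Section HomogeneousDeterminants.

Variable A : comNzRingType.
Local Notation form := {mpoly A[2]}.

Lemma dhomog_prod_ord e n (F : 'I_n -> form) :
  (forall i, F i \is e.-homog) -> \prod_i F i \is (n * e).-homog.
Proof.
elim: n F => [|n IHn] F homF; first by rewrite big_ord0 dhomog1.
by rewrite big_ord_recr mulSnr; apply: dhomogM => //; apply: IHn.
Qed.

Lemma dhomog_det e n (M : 'M[form]_n) :
  (forall i j, M i j \is e.-homog) -> \det M \is (n * e).-homog.
Proof.
move=> homM; apply: rpred_sum => s _; rewrite mulr_sign.
by case: ifP => _; rewrite ?rpredN; apply: dhomog_prod_ord.
Qed.

(* Coefficients expressing the mixed derivatives of a form of order M through
   the derivatives of its dehomogenization, by Euler's identity. *)
Fixpoint euler_coef (M k j l : nat) : {poly A} :=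
  if k is k'.+1 then
    (M - j - k')%:R * euler_coef M k' j l - 'X * euler_coef M k' j.+1 l
  else (l == j)%:R.

Lemma dehom_iter_mderiv M n (P : form) k j : P \is M.-homog -> (k + j < n)%N ->
  dehom (iter k (mderiv 0) (iter j (mderiv 1) P)) =
  \sum_(l < n) euler_coef M k j l * (dehom P)^`(l).
Proof.
move=> homP; elim: k j => [|k IHk] j lt_kj /=.
  rewrite (bigD1 (Ordinal lt_kj)) //= big1 => [|l l_j].
    rewrite eqxx mul1r addr0; elim: j {lt_kj} => //= j <-.
    exact: dehom_mderiv1.
  by rewrite [_ == j](negbTE l_j) mul0r.
have homQ := dhomog_iter_mderiv 0 k (dhomog_iter_mderiv 1 j homP).
rewrite (dehom_mderiv0 homQ) -dehom_mderiv1.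
have -> : mderiv 1 (iter k (mderiv 0) (iter j (mderiv 1) P)) =
          iter k (mderiv 0) (iter j.+1 (mderiv 1) P).
  by elim: k {IHk lt_kj homQ} => //= k <-; rewrite mderiv_comm.
rewrite !IHk; [|lia|lia]; rewrite !mulr_sumr -sumrB.
by apply: eq_bigr => l _; rewrite mulrBl !mulrA.
Qed.

End HomogeneousDeterminants.

(** * Factorization of the dehomogenized determinant G_r *)

Section Transvectants.

Variables (K : fieldType) (d : nat).
Hypotheses (charK : [pchar K] =i pred0) (d_gt1 : (1 < d)%N).

Local Notation A := {mpoly K[d.+1]}.
Local Notation F := (generic_form K d).
Local Notation f := (dehom F).

Lemma dhomog_binary_monomial m n : x1 K d ^+ m * x2 K d ^+ n \is (m + n).-homog.
Proof.
by apply: dhomogM; rewrite -[X in X.-homog]mul1n; apply: dhomogMn;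
  rewrite dhomogX; apply/eqP/mdeg1.
Qed.

Lemma dehom_binary_monomial m n : dehom (x1 K d ^+ m * x2 K d ^+ n) = 'X^n.
Proof.
by rewrite rmorphM !rmorphXn /= !dehomX !mnm1E /= expr1 expr0 expr1n mul1r.
Qed.

Lemma generic_form_homog : F \is d.-homog.
Proof.
apply: rpred_sum => i _; apply: dhomogZ.
by have := dhomog_binary_monomial (d - i) i; rewrite subnK // -ltnS.
Qed.

(** The constant coefficient of [f] is a_0, and d is nonzero in characteristic zero. *)
Lemma dehom_generic_neq0 : f *+ d != 0.
Proof.
apply/eqP => /(congr1 (fun p : {poly A} => p`_0)).
rewrite coefMn coef0 raddf_sum /= coef_sum big_ord_recl big1 => [|i _].
  rewrite dehomZ dehom_binary_monomial expr0 mulr1 coefC /= bin0 mulr1n addr0.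
  move/(congr1 (fun q : A => q@_U_(ord0))).
  rewrite mcoeffMn mcoeff0 mcoeffX eqxx.
  move/eqP; rewrite ((pcharf0P _).1 charK) => /eqP d0.
  by have := d_gt1; rewrite d0.
by rewrite dehomZ dehom_binary_monomial coefCM coefXn mulr0.
Qed.

Definition tscale r : A := ((r * d)%:R^-1 : K)%:MP.

Lemma C_homog r i : (0 < r)%N -> (i <= r)%N ->
  C_ K d r i \is (r.-1 + d.-1).-homog.
Proof.
move=> r_gt0 le_ir; have := dhomog_binary_monomial (r - i) i.
rewrite subnK // => homP; have homF := generic_form_homog.
by apply: dhomogZ; apply: rpredB; apply: dhomogM; apply: dhomog_mderiv.
Qed.

(** Euler's identity replaces both x_1-derivatives; the two terms in ['X] times a product of
    derivatives cancel. *)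
Lemma dehom_C r i : (i <= r)%N ->
  dehom (C_ K d r i) = tscale r *: ('X^i * f^`() *+ r - ('X^i)^`() * f *+ d).
Proof.
move=> le_ir; have := dhomog_binary_monomial (r - i) i.
rewrite subnK // => homP; rewrite dehomZ rmorphB !rmorphM /= !dehom_mderiv1.
rewrite (dehom_mderiv0 homP) (dehom_mderiv0 generic_form_homog).
rewrite dehom_binary_monomial mul_polyC; congr (_ *: _); last by ring.
by rewrite /tscale natrM.
Qed.

Definition powers_mx r : 'M[{poly A}]_r.+1 := \matrix_(i, m) ('X^i)^`(m).

Definition euler_mx r : 'M[{poly A}]_r.+1 :=
  \matrix_(l, j) euler_coef A (r.-1 + d.-1) (r - j) j l.

Lemma dehom_G r : (0 < r)%N ->
  dehom (G_ K d r) = (tscale r ^+ r.+1)%:P * \det (powers_mx r)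
    * wpow d f r r.+1 * \det (euler_mx r).
Proof.
move=> r_gt0; rewrite -(det_leibniz_mx dehom_generic_neq0) /G_ -det_map_mx.
set G := map_mx _ _.
have -> : G = (tscale r)%:P *: (powers_mx r *m leibniz_mx d f r *m euler_mx r).
  apply/matrixP => i j; rewrite !mxE.
  have le_ir : (i <= r)%N by rewrite -ltnS.
  have le_jr : (j <= r)%N by rewrite -ltnS.
  have homC := C_homog r_gt0 le_ir.
  rewrite [LHS](dehom_iter_mderiv (n := r.+1) homC); last by lia.
  rewrite mulr_sumr; apply: eq_bigr => l _; rewrite !mxE dehom_C // derivnZ.
  rewrite -scalerAr -mul_polyC; congr (_ * _); rewrite mulrC; congr (_ * _).
  pose H m := lcoef r d m l (('X^i)^`(m) * f^`(l.+1 - m)).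
  rewrite deriv_transvectant -(@sum_ord_widen _ l.+2 r.+2 H); first last.
  - by move=> m lt_lm; rewrite /H lcoef_small.
  - by rewrite !ltnS -ltnS.
  (* The term [m = r.+1], absent from [leibniz_mx], vanishes because ['X^i] has degree at most
     [r]. *)
  rewrite big_ord_recr /= [X in _ + X](_ : _ = 0) ?addr0.
    by apply: eq_bigr => m _; rewrite !mxE /H lcoef_mul.
  by rewrite /H derivn_poly0 ?size_polyXn // mul0r /lcoef !mul0rn subrr.
by rewrite detZ !det_mulmx polyC_exp !mulrA.
Qed.

Lemma G_homog r : (0 < r)%N -> G_ K d r \is (r.+1 * (r.-1 + d.-1 - r)).-homog.
Proof.
move=> r_gt0; apply: dhomog_det => i j; rewrite mxE.
have le_jr : (j <= r)%N by rewrite -ltnS.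
have le_ir : (i <= r)%N by rewrite -ltnS.
have homC := dhomog_iter_mderiv 1 j (C_homog r_gt0 le_ir).
have := dhomog_iter_mderiv 0 (r - j) homC.
by rewrite -subnDA subnKC.
Qed.

Lemma wpow12_J : ideal_poly (@J_ K 1 d) (wpow d f 1 2).
Proof.
have idJ : is_ideal (@J_ K 1 d) by apply: ideal_genP.
have d_neq0 n : (0 < n)%N -> n%:R != 0 :> K.
  by rewrite ((pcharf0P _).1 charK) lt0n.
(* For r = 1 the cofactors in [dehom_G] are constants: [tscale 1 ^+ 2], the determinant 1 of
   [powers_mx 1] and the determinant d - 1 of [euler_mx 1]. *)
pose c : K := (d%:R^-1) ^+ 2 * (d.-1)%:R.
have c_neq0 : c != 0.
  by rewrite mulf_neq0 ?expf_neq0 ?invr_eq0 ?d_neq0 //; lia.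
have -> : wpow d f 1 2 = (c^-1%:MP)%:P * dehom (G_ K d 1).
  have det2 (M : 'M[{poly A}]_2) : \det M = M 0 0 * M 1 1 - M 0 1 * M 1 0.
    rewrite (expand_det_row _ 0) !big_ord_recl big_ord0 /cofactor !det_mx11.
    rewrite !mxE /= expr0 mul1r addr0 expr1 mulN1r mulrN.
    by congr (_ * M _ _ - M _ _ * M _ _); exact: val_inj.
  rewrite dehom_G // !det2 !mxE /= !expr0 !expr1 derivX /=.
  have -> : 1^`() = 0 :> {poly A} by rewrite -polyC1 derivC.
  rewrite mul0r mul1r subr0 !mulr1 !mulr0 mul0r !subr0 /tscale mul1n.
  rewrite -mulrA [X in _ * X]mulrC !subn0 add0n -mulrA mulrCA.
  rewrite [X in _ * X](_ : _ = 1) ?mulr1 //.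
  rewrite -polyC_natr -mpolyC_nat -rmorphXn -!polyCM -!mpolyCM.
  by rewrite [X in _ * X]mulrC mulVf.
apply: (idealM (ideal_polyP idJ)); apply: ideal_dehom => // m.
by apply: ideal_gen_mem; exists m.
Qed.

End Transvectants.

(** * The inclusion of ideals *)

Lemma J_1_contains_J (K : fieldType) (d r : nat) (p : {mpoly K[d.+1]}) :
  [pchar K] =i pred0 -> (1 < d)%N -> (0 < r)%N ->
  @J_ K r d p -> @J_ K 1 d p.
Proof.
move=> charK d_gt1 r_gt0; have idJ : is_ideal (@J_ K 1 d) by apply: ideal_genP.
apply: ideal_gen_min => // _ [m ->].
have homG := @G_homog K d r r_gt0.
apply: (@ideal_homog _ _ idJ _ _ m homG).
rewrite dehom_G //; have idX := ideal_polyP idJ.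
rewrite mulrC; apply: (idealM idX); apply: (idealM idX).
(* The remaining factor [wpow d f r r.+1] has one more derivative than factors w. *)
apply: wpow_ideal => //; exact: wpow12_J.
Qed.

Theorem proposition5p3 (R : realType) (d r : nat) (hd : (2 <= d)%N)
    (hr : [\/ r = 2, r = 3 | r = 4]) (p : {mpoly (complex R)[d.+1]}) :
  @J_ (complex R) r d p -> @J_ (complex R) 1 d p.
Proof.
apply: J_1_contains_J => //; first exact: Num.Theory.pchar_num.
by case: hr => ->.
Qed.
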